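(* Let $\mathfrak g(V,\omega,D)$ be a generalized oscillator algebra with $V\neq\{0\}$. Then $\mathfrak g(V,\omega,D)$ contains non-trivial semi-equicontinuous coadjoint orbits if and only if it is isomorphic to a double extension $\mathfrak g(W,\kappa,E)$ defined by a continuous skew-symmetric operator $E\neq0$ on a locally convex euclidean space $(W,\kappa)$ (where $E$ integrates to a smooth $\kappa$-orthogonal one-parameter group on $W$).
   Context: $(V,\omega)$: real locally convex space with continuous non-degenerate alternating form $\omega$; $\gamma:\mathbb R\to\mathrm{Sp}(V,\omega)$ defines a smooth action, $D=\gamma'(0)$. $G(V,\omega,\gamma)=\mathbb R\times V\times\mathbb R$ with $(z,v,t)(z',v',t')=(z+z'+\frac12\omega(v,\gamma(t)v'),v+\gamma(t)v',t+t')$; Lie algebra $\mathfrak g(V,\omega,D)=\mathbb R\times V\times\mathbb R$ with bracket $[(z,v,t),(z',v',t')]=(\omega(v,v'),tDv'-t'Dv,0)$. Coadjoint orbits are $\mathrm{Ad}^*(G)$-orbits in the topological dual $\mathfrak g'$; non-trivial means not a single point; $E\subseteq\mathfrak g'$ is semi-equicontinuous if $y\mapsto\sup\langle E,-y\rangle$ is bounded on a neighborhood of some point. A locally convex euclidean space $(W,\kappa)$ is a real locally convex space with a continuous positive definite symmetric bilinear form $\kappa$. For a continuous $\kappa$-skew-symmetric operator $E$ on $W$, put $\omega_E(x,y):=\kappa(Ex,y)$; the double extension is $\mathfrak g(W,\kappa,E)=\mathbb R\times W\times\mathbb R$ with bracket $[(z,v,t),(z',v',t')]=(\kappa(Ev,v'),tEv'-t'Ev,0)$.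 *)

(* Defs.v *)
From HB Require Import structures.
From mathcomp Require Import all_boot all_order all_algebra.
From mathcomp Require Import all_classical all_reals all_analysis.

Set Implicit Arguments.
Unset Strict Implicit.
Unset Printing Implicit Defensive.

Import Order.TTheory GRing.Theory Num.Theory.
Import numFieldTopology.Exports numFieldNormedType.Exports.

Local Open Scope classical_set_scope.
Local Open Scope ring_scope.

Section GOA.
Context {R : realType}.

Definition is_linear_map {X Y : tvsType R} (f : X -> Y) : Prop :=
  forall (a : R) (x y : X), f (a *: x + y) = a *: f x + f y.

Definition is_linear_form {X : tvsType R} (f : X -> R) : Prop :=
  forall (a : R) (x y : X), f (a *: x + y) = a * f x + f y.

Definition is_bilinear {X : tvsType R} (b : X -> X -> R) : Prop :=
  forall (a : R) (x y z : X),
    b (a *: x + y) z = a * b x z + b y z /\ b z (a *: x + y) = a * b z x + b z y.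

Definition bicontinuous {X : tvsType R} (b : X -> X -> R) : Prop :=
  continuous (fun p : X * X => b p.1 p.2).

Definition diffq {X Y : tvsType R} (f : X -> Y) (x h : X) : R -> Y :=
  fun t => t^-1 *: (f (x + t *: h) - f x).

(* C^k in the sense of Bastiani: f continuous, all directional derivatives
   exist and df : X x X -> Y is C^(k-1). *)
Fixpoint Ck {Y : tvsType R} (k : nat) : forall (X : tvsType R), (X -> Y) -> Prop :=
  match k with
  | 0 => fun X f => continuous f
  | k.+1 => fun X f => continuous f /\
      exists df : (X * X)%type -> Y,
        (forall x h : X, diffq f x h @ (0 : R)^' --> df (x, h)) /\
        @Ck Y k (X * X)%type df
  end.

Definition smooth {X Y : tvsType R} (f : X -> Y) : Prop := forall k, @Ck Y k X f.

Definition symplectic_form {V : tvsType R} (om : V -> V -> R) : Prop :=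
  [/\ is_bilinear om, bicontinuous om, (forall v, om v v = 0) &
      (forall v, (forall w, om v w = 0) -> v = 0)].

Definition smooth_symplectic_action {V : tvsType R} (om : V -> V -> R)
    (gam : R -> V -> V) : Prop :=
  [/\ (forall t, is_linear_map (gam t) /\ continuous (gam t) /\
          forall v w, om (gam t v) (gam t w) = om v w),
      gam 0 = id,
      (forall s t, gam (s + t) = gam s \o gam t) &
      smooth (fun p : (R^o * V)%type => gam p.1 p.2)].

Definition is_generator {V : tvsType R} (gam : R -> V -> V) (D : V -> V) : Prop :=
  forall v, (fun t : R => t^-1 *: (gam t v - v)) @ (0 : R)^' --> D v.

(* elements (z, v, t) are encoded as ((z, v), t) *)
Definition trip (V : tvsType R) := ((R^o * V) * R^o)%type.

Definition gmul {V : tvsType R} (om : V -> V -> R) (gam : R -> V -> V)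
    (g h : trip V) : trip V :=
  ((g.1.1 + h.1.1 + 2^-1 * om g.1.2 (gam g.2 h.1.2), g.1.2 + gam g.2 h.1.2),
   g.2 + h.2).

Definition ginv {V : tvsType R} (gam : R -> V -> V) (g : trip V) : trip V :=
  ((- g.1.1, - gam (- g.2) g.1.2), - g.2).

Definition gconj {V : tvsType R} (om : V -> V -> R) (gam : R -> V -> V)
    (g x : trip V) : trip V :=
  gmul om gam (gmul om gam g x) (ginv gam g).

(* A = Ad(g) = T_1(c_g), the derivative at the identity (0,0,0) of the
   conjugation c_g (G is the open set trip V of a locally convex space) *)
Definition is_Ad {V : tvsType R} (om : V -> V -> R) (gam : R -> V -> V)
    (g : trip V) (A : trip V -> trip V) : Prop :=
  forall x : trip V,
    (fun s : R => s^-1 *: gconj om gam g (s *: x)) @ (0 : R)^' --> A x.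

Definition osc_bracket {V : tvsType R} (om : V -> V -> R) (D : V -> V)
    (x y : trip V) : trip V :=
  ((om x.1.2 y.1.2, x.2 *: D y.1.2 - y.2 *: D x.1.2), 0).

Definition in_dual {V : tvsType R} (l : trip V -> R) : Prop :=
  is_linear_form l /\ continuous l.

Definition coadj_orbit {V : tvsType R} (om : V -> V -> R) (gam : R -> V -> V)
    (l : trip V -> R) : set (trip V -> R) :=
  [set m | exists g A, is_Ad om gam (ginv gam g) A /\ m = l \o A].

Definition nontrivial_set {T} (O : set T) : Prop := ~ exists x, O = [set x].

Definition semi_equicontinuous {X : tvsType R} (E : set (X -> R)) : Prop :=
  exists x0 : X, exists U : set X, nbhs x0 U /\
    exists M : R, forall y, U y ->
      (`| ereal_sup [set (m (- y))%:E | m in E] | <= M%:E)%E.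

Definition euclidean_form {W : tvsType R} (ka : W -> W -> R) : Prop :=
  [/\ is_bilinear ka, bicontinuous ka, (forall x y, ka x y = ka y x) &
      (forall w, w <> 0 -> 0 < ka w w)].

Definition skew_operator {W : tvsType R} (ka : W -> W -> R) (E : W -> W) : Prop :=
  [/\ is_linear_map E, continuous E & forall x y, ka (E x) y = - ka x (E y)].

Definition smooth_orthogonal_action {W : tvsType R} (ka : W -> W -> R)
    (del : R -> W -> W) : Prop :=
  [/\ (forall t, is_linear_map (del t) /\ continuous (del t) /\
          forall v w, ka (del t v) (del t w) = ka v w),
      del 0 = id,
      (forall s t, del (s + t) = del s \o del t) &
      smooth (fun p : (R^o * W)%type => del p.1 p.2)].

Definition dext_bracket {W : tvsType R} (ka : W -> W -> R) (E : W -> W)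
    (x y : trip W) : trip W :=
  ((ka (E x.1.2) y.1.2, x.2 *: E y.1.2 - y.2 *: E x.1.2), 0).

Definition lie_iso {X Y : tvsType R} (bX : X -> X -> X) (bY : Y -> Y -> Y) : Prop :=
  exists (phi : X -> Y) (psi : Y -> X),
    [/\ is_linear_map phi, continuous phi, continuous psi,
        cancel phi psi /\ cancel psi phi &
        forall x y, phi (bX x y) = bY (phi x) (phi y)].

End GOA.

(* Main.v *)
(** The adjoint action is
    [Ad(z, v, t)(z', v', t') =
       (z' + om v (gam t v') - t'/2 om v (D v), gam t v' - t' D v, t')].

    Let [l = (lam, al, mu)] have a semi-equicontinuous orbit.  If [lam = 0],
    finiteness of the supremum at a point with [t' <> 0] forces [al \o D = 0],
    so [al] is [gam]-invariant and the orbit is a point.  If [lam <> 0], the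
    bound reads [om v h <= M + c om v (D v)] for all [v] and all [h] near [0].
    After changing the sign of [om] (the isomorphism [z |-> - z]) we have
    [c > 0], and [q x = sup_v (2 om v x - om v (D v))], the dual norm of
    [om v (D v)], is a continuous quadratic form.  Since
    [q (D x + y) = q y + om x (D x) + 2 om x y], its polarization [ka]
    satisfies [ka (D x) y = om x y]: one takes [W = V] and [E = D].

    Conversely, an isomorphism [phi] onto a double extension maps
    [R x V x {0}] into [R x W x {0}] and [(1, 0, 0)] to [(c, 0, 0)].  With [P]
    its component from [V] to [W] and [a] its component from the last [R] to
    the last [R], one gets [c om v w = ka (E P v) (P w)] and [P D = a E P],
    whence [om v (D v) = (a / c) |E P v|^2], and completing the square bounds
    the orbit of the functional [(z, v, t) |-> z]. *)

Require Import Defs.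
From HB Require Import structures.
From mathcomp Require Import all_boot all_order all_algebra.
From mathcomp Require Import all_classical all_reals all_analysis.
From mathcomp Require Import ring lra.
Import Order.TTheory GRing.Theory Num.Theory.
Import numFieldTopology.Exports numFieldNormedType.Exports.

Set Implicit Arguments.
Unset Strict Implicit.
Unset Printing Implicit Defensive.

Local Open Scope classical_set_scope.
Local Open Scope ring_scope.

(** * Polarization of quadratic forms by the Jordan-von Neumann argument *)

Lemma bounded_additive_linear (R : realType) (f : R -> R) (K : R) :
  {morph f : x y / x + y} -> (forall t, 0 <= t <= 1 -> `|f t| <= K) ->
  forall t, f t = t * f 1.
Proof.
(* [g] measures the failure of linearity: it is additive and vanishes at 1, hence on all
   integers. *)
move=> fD fK t; pose g s := f s - s * f 1.
have gD : {morph g : x y / x + y} by move=> x y; rewrite /g fD; ring.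
have g1 : g 1 = 0 by rewrite /g mul1r subrr.
have g0 : g 0 = 0.
  by apply: (addrI (g 0)); rewrite -gD !addr0.
have gN x : g (- x) = - g x by apply: (addrI (g x)); rewrite -gD !subrr.
have gMn n x : g (n%:R * x) = n%:R * g x.
  elim: n => [|n IH]; first by rewrite !mul0r g0.
  by rewrite -natr1 !mulrDl !mul1r gD IH.
have gz (z : int) : g z%:~R = 0.
  have gn n : g n%:R = 0 by rewrite -[n%:R]mulr1 gMn g1 mulr0.
  by case: z => n; [exact: gn | rewrite NegzE mulrNz gN gn oppr0].
(* [g] is 1-periodic, so the bound on the unit interval is global *)
have gK s : `|g s| <= K + `|f 1|.
  have -> : g s = g (s - (Num.floor s)%:~R) by rewrite gD gN gz subr0.
  have /andP[s0 s1] := floor_itv s.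
  set u := s - _; have u01 : 0 <= u <= 1.
    rewrite /u subr_ge0 s0 /= lerBlDl; apply: ltW.
    by move: s1; rewrite intrD.
  rewrite /g (le_trans (ler_normB _ _))// lerD// ?fK// normrM ler_piMl//.
  by case/andP: u01 => u0 u1; rewrite ger0_norm.
apply/eqP; rewrite -subr_eq0; apply/negPn/negP => gt.
have gt0 : 0 < `|g t| by rewrite normr_gt0.
(* Integer multiples of [t] multiply [g t], so by the Archimedean property a nonzero [g t] would
   break the global bound. *)
have := gK ((Num.bound ((K + `|f 1|) / `|g t|))%:R * t).
rewrite gMn normrM normr_nat leNgt -ltr_pdivrMr// => /negP; apply.
by apply: archi_boundP; rewrite divr_ge0// (le_trans _ (gK 0)).
Qed.

Section QuadraticForm.
Context {R : realType} {V : lmodType R} (q : V -> R).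

Definition polar (x y : V) : R := (q (x + y) - q x - q y) / 2.

Hypothesis q_ge0 : forall x, 0 <= q x.
Hypothesis qZ : forall r x, q (r *: x) = r ^+ 2 * q x.
Hypothesis q_parallelogram :
  forall x y, q (x + y) + q (x - y) = 2 * (q x + q y).

Lemma polarC x y : polar x y = polar y x.
Proof. by rewrite /polar (addrC x y) addrAC. Qed.

Lemma polarxx x : polar x x = q x.
Proof.
have -> : polar x x = (q (2 *: x) - q x - q x) / 2.
  by rewrite /polar scaler_nat mulr2n.
by rewrite qZ; field.
Qed.

(** Four instances of the parallelogram law combine to express [q (x + y + z)] through the values of
    [q] on pairwise sums and single vectors. *)
Lemma polarDl x y z : polar (x + y) z = polar x z + polar y z.
Proof.
have A := q_parallelogram (x + y) z.
have B := q_parallelogram (x + z) y.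
have C := q_parallelogram x (y - z).
have D := q_parallelogram y z.
move: A B C D; rewrite !addrA opprB addrA.
rewrite (addrAC x z y) => A B C D.
by rewrite /polar; lra.
Qed.

Lemma polar_le x y : `|polar x y| <= (q x + q y) / 2.
Proof.
have := q_parallelogram x y; have := q_ge0 (x + y); have := q_ge0 (x - y).
by rewrite ler_norml /polar; lra.
Qed.

(** Homogeneity comes without continuity of [q]: [t |-> polar (t *: x) y] is additive, and
    [polar_le] bounds it on the unit interval. *)
Lemma polarZl r x y : polar (r *: x) y = r * polar x y.
Proof.
have H := @bounded_additive_linear R (fun t => polar (t *: x) y)
  ((q x + q y) / 2) _ _ r.
rewrite H ?scale1r//.
- by move=> s t; rewrite scalerDl polarDl.
move=> t /andP[t0 t1]; apply: (le_trans (polar_le _ _)).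
rewrite qZ ler_pM2r// lerD2r ler_piMl// expr2.
by rewrite -[leRHS]mulr1 ler_pM.
Qed.

(** A weighted form of Cauchy-Schwarz, from rescaling [x] by [k] and [y] by [k^-1]; the free weight
    serves the continuity of the dual form. *)
Lemma polar_weighted k x y : k != 0 ->
  `|polar x y| <= (k ^+ 2 * q x + k ^- 2 * q y) / 2.
Proof.
move=> k0; have := polar_le (k *: x) (k^-1 *: y).
by rewrite polarZl polarC polarZl polarC mulrA divff// mul1r !qZ exprVn.
Qed.

End QuadraticForm.

(** * Algebra of bilinear forms and linear maps *)

Section BilinearForm.
Context {R : realType} {X : tvsType R} (b : X -> X -> R).
Hypothesis b_bilin : is_bilinear b.

Lemma bilDl x y z : b (x + y) z = b x z + b y z.
Proof. by have [+ _] := b_bilin 1 x y z; rewrite scale1r mul1r. Qed.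

Lemma bilDr z x y : b z (x + y) = b z x + b z y.
Proof. by have [_] := b_bilin 1 x y z; rewrite scale1r mul1r. Qed.

Lemma bil0l z : b 0 z = 0.
Proof. by apply: (addrI (b 0 z)); rewrite -bilDl !addr0. Qed.

Lemma bil0r z : b z 0 = 0.
Proof. by apply: (addrI (b z 0)); rewrite -bilDr !addr0. Qed.

Lemma bilZl a x z : b (a *: x) z = a * b x z.
Proof. by have [+ _] := b_bilin a x 0 z; rewrite addr0 bil0l addr0. Qed.

Lemma bilZr a z x : b z (a *: x) = a * b z x.
Proof. by have [_] := b_bilin a x 0 z; rewrite addr0 bil0r addr0. Qed.

Lemma bilNl x z : b (- x) z = - b x z.
Proof. by rewrite -scaleN1r bilZl mulN1r. Qed.

Lemma bilNr z x : b z (- x) = - b z x.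
Proof. by rewrite -scaleN1r bilZr mulN1r. Qed.

Lemma bilBl x y z : b (x - y) z = b x z - b y z.
Proof. by rewrite bilDl bilNl. Qed.

Lemma bilBr z x y : b z (x - y) = b z x - b z y.
Proof. by rewrite bilDr bilNr. Qed.

Lemma alternating_antisym : (forall v, b v v = 0) ->
  forall v w, b v w = - b w v.
Proof.
move=> b0 v w; have := b0 (v + w).
by rewrite bilDl !bilDr !b0 add0r addr0 => /eqP; rewrite addr_eq0 => /eqP.
Qed.

End BilinearForm.

Section LinearMap.
Context {R : realType} {X Y : tvsType R}.

Lemma linmapD (f : X -> Y) : is_linear_map f -> {morph f : x y / x + y}.
Proof. by move=> fl x y; have := fl 1 x y; rewrite !scale1r. Qed.

Lemma linmap0 (f : X -> Y) : is_linear_map f -> f 0 = 0.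
Proof.
by move=> fl; apply: (addrI (f 0)); rewrite -(linmapD fl) !addr0.
Qed.

Lemma linmapZ (f : X -> Y) : is_linear_map f ->
  forall a, {morph f : x / a *: x}.
Proof. by move=> fl a x; have := fl a x 0; rewrite linmap0// !addr0. Qed.

Lemma linmapN (f : X -> Y) : is_linear_map f -> {morph f : x / - x}.
Proof. by move=> fl x; rewrite -scaleN1r linmapZ// scaleN1r. Qed.

Lemma linmapB (f : X -> Y) : is_linear_map f -> {morph f : x y / x - y}.
Proof. by move=> fl x y; rewrite linmapD// linmapN. Qed.

End LinearMap.

(** * Limits in topological vector spaces *)

Lemma cvg_prod {T : Type} {F : set_system T} {FF : Filter F}
    {X Y : topologicalType} (f : T -> X) (g : T -> Y) (a : X) (b : Y) :
  f @ F --> a -> g @ F --> b -> (fun t => (f t, g t)) @ F --> (a, b).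
Proof. by move=> fa gb; exact: (cvg_pair fa gb). Qed.

Lemma continuous_fst (X Y : topologicalType) : continuous (@fst X Y).
Proof. by move=> [x y]; exact: cvg_fst. Qed.

Lemma continuous_snd (X Y : topologicalType) : continuous (@snd X Y).
Proof. by move=> [x y]; exact: cvg_snd. Qed.

Section TvsLimits.
Context {R : realType} {X : tvsType R} {T : Type}.
Context {F : set_system T} {FF : Filter F}.

Lemma tvs_cvgD (f g : T -> X) (a b : X) :
  f @ F --> a -> g @ F --> b -> (fun t => f t + g t) @ F --> a + b.
Proof.
move=> fa gb.
exact: (cvg_comp (fun t => (f t, g t)) (fun p : X * X => p.1 + p.2)
  (cvg_pair fa gb) (@add_continuous X (a, b))).
Qed.

Lemma tvs_cvgZ (k : T -> R) (f : T -> X) (r : R) (a : X) :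
  k @ F --> r -> f @ F --> a -> (fun t => k t *: f t) @ F --> r *: a.
Proof.
move=> kr fa.
exact: (cvg_comp (fun t => (k t, f t)) (fun p : R^o * X => p.1 *: p.2)
  (cvg_pair kr fa) (@scale_continuous R X (r, a))).
Qed.

Lemma tvs_cvgZl (k : R) (f : T -> X) (a : X) :
  f @ F --> a -> (fun t => k *: f t) @ F --> k *: a.
Proof. by move=> fa; apply: tvs_cvgZ => //; exact: cvg_cst. Qed.

Lemma tvs_cvgN (f : T -> X) (a : X) :
  f @ F --> a -> (fun t => - f t) @ F --> - a.
Proof.
by move=> fa; exact: (cvg_comp f -%R fa (@opp_continuous X a)).
Qed.

Lemma tvs_cvgB (f g : T -> X) (a b : X) :
  f @ F --> a -> g @ F --> b -> (fun t => f t - g t) @ F --> a - b.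
Proof. by move=> fa gb; apply: tvs_cvgD => //; exact: tvs_cvgN. Qed.

Lemma bilinear_cvg (b : X -> X -> R) (f g : T -> X) (x y : X) :
  bicontinuous b -> f @ F --> x -> g @ F --> y ->
  (fun t => b (f t) (g t)) @ F --> b x y.
Proof.
move=> bc fx gy.
exact: (cvg_comp (fun t => (f t, g t)) (fun p : X * X => b p.1 p.2)
  (cvg_pair fx gy) (bc (x, y))).
Qed.

End TvsLimits.

(** [tvsType] carries no separation axiom; by non-degeneracy the continuous real functions [om _ w]
    separate the points of [V], and limits in [R] are unique. *)
Lemma symplectic_cvg_unique {R : realType} {V : tvsType R} (om : V -> V -> R)
    {T : Type} (F : set_system T) {FF : ProperFilter F} (f : T -> V) (a b : V) :
  symplectic_form om -> f @ F --> a -> f @ F --> b -> a = b.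
Proof.
move=> [bil bic alt nd] fa fb; apply/eqP; rewrite -subr_eq0; apply/eqP.
apply: nd => w; rewrite bilBl//; apply/eqP; rewrite subr_eq0; apply/eqP.
have H c : f @ F --> c -> (fun t => om (f t) w) @ F --> om c w.
  by move=> fc; apply: bilinear_cvg => //; exact: cvg_cst.
by apply: (cvg_unique _ (H _ fa) (H _ fb)); exact: Rhausdorff.
Qed.

(** * The generator of the symplectic one-parameter group *)

Section Generator.
Context {R : realType} {V : tvsType R} {om : V -> V -> R}.
Context {gam : R -> V -> V} {D : V -> V}.
Hypothesis om_sympl : symplectic_form om.
Hypothesis gam_act : smooth_symplectic_action om gam.
Hypothesis D_gen : is_generator gam D.

Lemma gam_linear t : is_linear_map (gam t).
Proof. by case: gam_act => /(_ t)[]. Qed.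

Lemma gam_continuous t : continuous (gam t).
Proof. by case: gam_act => /(_ t)[_ []]. Qed.

Lemma gam_om t v w : om (gam t v) (gam t w) = om v w.
Proof. by case: gam_act => /(_ t)[_ [_]]. Qed.

Lemma gam0 v : gam 0 v = v.
Proof. by case: gam_act => _ ->. Qed.

Lemma gamD s t v : gam (s + t) v = gam s (gam t v).
Proof. by case: gam_act => _ _ ->. Qed.

Lemma gamNK t v : gam (- t) (gam t v) = v.
Proof. by rewrite -gamD addNr gam0. Qed.

Lemma gamKN t v : gam t (gam (- t) v) = v.
Proof. by rewrite -gamD subrr gam0. Qed.

Lemma gam_orbit_continuous v : continuous (fun t : R => gam t v).
Proof.
case: gam_act => _ _ _ /(_ 0%N) /= gc t.
apply: (cvg_comp (fun s : R => (s, v)) (fun p : (R^o * V)%type => gam p.1 p.2)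
  _ (gc (t, v))).
by apply: (@cvg_prod _ _ _ R^o); [exact: cvg_id | exact: cvg_cst].
Qed.

Lemma gam_cvg0 v : (fun t : R => gam t v) @ (0 : R)^' --> v.
Proof.
rewrite -[X in _ --> X]gam0.
by apply: cvg_within_filter; exact: gam_orbit_continuous.
Qed.

Lemma generator_linear : is_linear_map D.
Proof.
move=> a x y; apply: (symplectic_cvg_unique (F := 0^') om_sympl (@D_gen _)).
have -> : (fun t : R => t^-1 *: (gam t (a *: x + y) - (a *: x + y)))
  = (fun t => a *: (t^-1 *: (gam t x - x)) + t^-1 *: (gam t y - y)).
  apply/funext => t; rewrite gam_linear scalerA mulrC -scalerA -scalerDr.
  by rewrite opprD addrACA -scalerBr.
by apply: tvs_cvgD => //; exact: tvs_cvgZl.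
Qed.

Lemma generator_gam t v : D (gam t v) = gam t (D v).
Proof.
apply: (symplectic_cvg_unique (F := 0^') om_sympl (@D_gen _)).
have -> : (fun s : R => s^-1 *: (gam s (gam t v) - gam t v))
  = (fun s => gam t (s^-1 *: (gam s v - v))).
  apply/funext => s; rewrite (linmapZ (gam_linear t)) (linmapB (gam_linear t)).
  by rewrite -!gamD (addrC s t).
by apply: continuous_cvg; [exact: gam_continuous | exact: D_gen].
Qed.

Lemma generator_om v w : om (D v) w = - om v (D w).
Proof.
have [bil bic _ _] := om_sympl.
(* Product rule: the two terms telescope to the difference quotient of the constant
   [om (gam s v) (gam s w)]. *)
have H : (fun s : R => om (s^-1 *: (gam s v - v)) (gam s w)
    + om v (s^-1 *: (gam s w - w))) @ 0^' --> om (D v) w + om v (D w).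
  apply: cvgD; apply: bilinear_cvg => //; [exact: gam_cvg0 | exact: cvg_cst].
have H0 : (fun s : R => om (s^-1 *: (gam s v - v)) (gam s w)
    + om v (s^-1 *: (gam s w - w))) @ 0^' --> (0 : R).
  rewrite (_ : (fun s => _) = cst 0); first exact: cvg_cst.
  apply/funext => s /=.
  by rewrite (bilZl bil) (bilZr bil) (bilBl bil) (bilBr bil) gam_om; ring.
by apply/eqP; rewrite -addr_eq0; apply/eqP; apply: (cvg_unique _ H H0).
Qed.

Lemma generator_continuous : continuous D.
Proof.
case: gam_act => _ _ _ /(_ 1%N) /= [_ [df [dfP dfc]]].
(* [D v] is the derivative of the action map at [(0, v)] in the direction [(1, 0)], and the C^1
   condition makes the differential jointly continuous. *)
have -> : D = fun v => df ((0, v), (1, 0)).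
  apply/funext => v; apply: (symplectic_cvg_unique (F := 0^') om_sympl (@D_gen v)).
  have := dfP (0, v) (1, 0).
  rewrite (_ : diffq _ _ _ = fun t : R => t^-1 *: (gam t v - v))//.
  apply/funext => t; rewrite /diffq /= scaler0 addr0 add0r gam0.
  by rewrite [t *: 1]mulr1.
move=> v; apply: (cvg_comp (fun v : V => ((0, v), (1, 0)) : (R^o * V) * (R^o * V)) df
  _ (dfc ((0, v), (1, 0)))).
apply: cvg_prod; last exact: cvg_cst.
by apply: cvg_prod; [exact: cvg_cst | exact: cvg_id].
Qed.

End Generator.

(** * The adjoint action and the coadjoint orbits in explicit form *)

Definition osc_Ad {R : realType} {V : tvsType R} (om : V -> V -> R)
    (gam : R -> V -> V) (D : V -> V) (g x : trip V) : trip V :=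
  ((x.1.1 + om g.1.2 (gam g.2 x.1.2) - x.2 / 2 * om g.1.2 (D g.1.2),
    gam g.2 x.1.2 - x.2 *: D g.1.2), x.2).

Lemma cvg_dnbhs0M (R : realType) (c : R) : c != 0 ->
  (fun s : R => s * c) @ 0^' --> 0^'.
Proof.
move=> c0 A; rewrite /dnbhs /within /= => A0.
have /(_ _ A0) : (fun s : R => s * c) @ (0 : R) --> (0 : R).
  by rewrite -[X in _ --> X](mul0r c); apply: cvgM; [exact: cvg_id|exact: cvg_cst].
move=> B0; apply: (@filterS _ (nbhs (0 : R)) _ _ _ _ B0) => s /= As s0.
by apply: As; rewrite mulf_neq0.
Qed.

Section Adjoint.
Context {R : realType} {V : tvsType R} {om : V -> V -> R}.
Context {gam : R -> V -> V} {D : V -> V}.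
Hypothesis om_sympl : symplectic_form om.
Hypothesis gam_act : smooth_symplectic_action om gam.
Hypothesis D_gen : is_generator gam D.

(** An exact formula before the limit: [s] enters only through [gam (s * x.2) g.1.2] and its
    difference quotient, so the limit can be taken coordinatewise. *)
Lemma gconj_scale (g x : trip V) (s : R) : s != 0 ->
  s^-1 *: gconj om gam g (s *: x) =
  ((x.1.1 + om g.1.2 (gam g.2 x.1.2) / 2
      - om g.1.2 (s^-1 *: (gam (s * x.2) g.1.2 - g.1.2)) / 2
      - om (gam g.2 x.1.2) (gam (s * x.2) g.1.2) / 2,
    gam g.2 x.1.2 - s^-1 *: (gam (s * x.2) g.1.2 - g.1.2)), x.2).
Proof.
have [bil _ alt _] := om_sympl.
have gl t := gam_linear gam_act t.
case: g x => [[z v] t] [[z' v'] t'] s0.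
rewrite /gconj /gmul /ginv /=.
have tE : t + s *: t' - t = s * t' by rewrite addrAC subrr add0r.
rewrite (linmapN (gl _)) -(gamD gam_act) tE !(linmapZ (gl _)).
rewrite (bilZr bil) (bilNr bil) (bilDl bil) !(bilZl bil) (bilZr bil) (bilBr bil) alt.
congr (_, _, _).
- by rewrite /= [in LHS]/GRing.scale /=; field.
- rewrite /= -[X in _ = X - _](scale1r (gam t v')) -(mulVf s0) -scalerA.
  by rewrite -scalerBr opprB addrA (addrC v).
- by rewrite /= [in LHS]/GRing.scale /= mulKf.
Qed.

Lemma generator_cvg_scale (v : V) (c : R) :
  (fun s : R => s^-1 *: (gam (s * c) v - v)) @ 0^' --> c *: D v.
Proof.
(* For [c = 0] the substitution [s * c] does not stay in a punctured neighborhood of 0. *)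
have [->|c0] := eqVneq c 0.
  rewrite (_ : (fun s => _) = cst (0 *: D v)); first exact: cvg_cst.
  by apply/funext => s; rewrite mulr0 (gam0 gam_act) subrr scaler0 scale0r.
rewrite (_ : (fun s => _) =
    (fun s => c *: ((s * c)^-1 *: (gam (s * c) v - v)))).
  by apply: tvs_cvgZl; exact: (cvg_comp _ _ (cvg_dnbhs0M c0) (@D_gen v)).
by apply/funext => s; rewrite scalerA invfM mulrCA divff// mulr1.
Qed.

Lemma osc_AdP (g : trip V) : is_Ad om gam g (osc_Ad om gam D g).
Proof.
have [bil bic alt _] := om_sympl.
move=> x.
have E := @generator_cvg_scale g.1.2 x.2.
have G : (fun s : R => gam (s * x.2) g.1.2) @ 0^' --> g.1.2.
  rewrite -[X in _ --> X](gam0 gam_act).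
  have M0 : (fun s : R => s * (x.2 : R)) @ 0^' --> (0 : R).
    rewrite -[X in _ --> X](mul0r (x.2 : R)).
    by apply: cvgM; [exact: cvg_within_filter | exact: cvg_cst].
  exact: (cvg_comp _ (fun t => gam t g.1.2) M0
    (@gam_orbit_continuous _ _ _ _ gam_act _ 0)).
apply: cvg_trans.
  apply: near_eq_cvg; near=> s; apply/esym/gconj_scale.
  by near: s; exact: nbhs_dnbhs_neq.
rewrite /osc_Ad; apply: cvg_prod; last exact: cvg_cst.
apply: cvg_prod; last by apply: tvs_cvgB => //; exact: cvg_cst.
(* By antisymmetry the two halves of the [om] term, one from each product in the conjugation, add
   up. *)
have -> : x.1.1 + om g.1.2 (gam g.2 x.1.2) - x.2 / 2 * om g.1.2 (D g.1.2)
  = x.1.1 + om g.1.2 (gam g.2 x.1.2) / 2 - om g.1.2 (x.2 *: D g.1.2) / 2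
    - om (gam g.2 x.1.2) g.1.2 / 2.
  by rewrite (bilZr bil) (alternating_antisym bil alt (gam _ _)); field.
have half (f : R -> R) (a : R) : f @ 0^' --> a -> (fun s => f s / 2) @ 0^' --> a / 2.
  by move=> fa; apply: cvgM => //; exact: cvg_cst.
have c1 : (fun s : R => om g.1.2 (s^-1 *: (gam (s * x.2) g.1.2 - g.1.2)) / 2)
    @ 0^' --> om g.1.2 (x.2 *: D g.1.2) / 2.
  by apply: half; apply: bilinear_cvg => //; exact: cvg_cst.
have c2 : (fun s : R => om (gam g.2 x.1.2) (gam (s * x.2) g.1.2) / 2)
    @ 0^' --> om (gam g.2 x.1.2) g.1.2 / 2.
  by apply: half; apply: bilinear_cvg => //; exact: cvg_cst.
exact: (cvgB (cvgB (cvg_cst _) c1) c2).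
Unshelve. all: by end_near. Qed.

Lemma osc_Ad_unique (g : trip V) A :
  is_Ad om gam g A -> A = osc_Ad om gam D g.
Proof.
move=> AP; apply/funext => x.
pose f (s : R) : trip V := s^-1 *: gconj om gam g (s *: x).
have f1 (u : trip V) : f @ 0^' --> u -> (fun s => (f s).1) @ 0^' --> u.1.
  by move=> fu; exact: (cvg_comp _ _ fu (@continuous_fst _ _ u)).
have f2 (u : trip V) : f @ 0^' --> u -> (fun s => (f s).2) @ 0^' --> u.2.
  by move=> fu; exact: (cvg_comp _ _ fu (@continuous_snd _ _ u)).
have f11 (u : trip V) : f @ 0^' --> u -> (fun s => (f s).1.1) @ 0^' --> u.1.1.
  by move=> /f1 fu; exact: (cvg_comp _ _ fu (@continuous_fst _ _ u.1)).
have f12 (u : trip V) : f @ 0^' --> u -> (fun s => (f s).1.2) @ 0^' --> u.1.2.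
  by move=> /f1 fu; exact: (cvg_comp _ _ fu (@continuous_snd _ _ u.1)).
have fA : f @ 0^' --> A x by exact: AP.
have fB : f @ 0^' --> osc_Ad om gam D g x by exact: osc_AdP.
rewrite [A x]surjective_pairing [(A x).1]surjective_pairing.
rewrite [RHS]surjective_pairing [(osc_Ad _ _ _ _ _).1]surjective_pairing.
congr (_, _, _).
- by apply: (cvg_unique _ (f11 _ fA) (f11 _ fB)); exact: Rhausdorff.
- exact: (symplectic_cvg_unique om_sympl (f12 _ fA) (f12 _ fB)).
- by apply: (cvg_unique _ (f2 _ fA) (f2 _ fB)); exact: Rhausdorff.
Qed.

Lemma ginvK (g : trip V) : ginv gam (ginv gam g) = g.
Proof.
case: g => [[z v] t]; rewrite /ginv /= !opprK.
by rewrite (linmapN (gam_linear gam_act _)) opprK (gamKN gam_act).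
Qed.

Lemma coadj_orbitE l : coadj_orbit om gam l =
  [set m | exists g, m = l \o osc_Ad om gam D g].
Proof.
apply/seteqP; split => m /=.
  by move=> [g [A [/osc_Ad_unique -> ->]]]; exists (ginv gam g).
move=> [g ->]; exists (ginv gam g), (osc_Ad om gam D g); split => //.
by rewrite ginvK; exact: osc_AdP.
Qed.

End Adjoint.

(** * The dual quadratic form and the euclidean structure it defines *)

Section DualForm.
Context {R : realType} {V : tvsType R} {om : V -> V -> R} {D : V -> V}.
Hypothesis om_sympl : symplectic_form om.
Hypothesis D_linear : is_linear_map D.
Hypothesis D_om : forall v w, om (D v) w = - om v (D w).
Context {N : set V} {M C : R}.
Hypothesis N0 : nbhs 0 N.
Hypothesis C_gt0 : 0 < C.
Hypothesis om_le : forall v h, N h -> om v h <= M + C * om v (D v).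

Let bil : is_bilinear om. Proof. by case: om_sympl. Qed.

Let B v := om v (D v).

(** A Legendre transform of [om v (D v)]. The real [sup] is meaningful only for a set bounded above,
    which [dual_has_sup] provides. *)
Definition dual_form (x : V) : R :=
  sup [set 2 * om v x - om v (D v) | v in setT].

Let B_D v w : B (v + w) = B v + B w + 2 * om v (D w).
Proof.
rewrite /B (linmapD D_linear) (bilDl bil) !(bilDr bil).
have [_ _ alt _] := om_sympl.
have -> : om w (D v) = om v (D w).
  by rewrite (alternating_antisym bil alt) D_om opprK.
by ring.
Qed.

Let B_Z k v : B (k *: v) = k ^+ 2 * B v.
Proof. by rewrite /B (linmapZ D_linear) (bilZl bil) (bilZr bil) mulrA. Qed.

Let M_ge0 : 0 <= M.
Proof.
have := @om_le 0 0 (nbhs_singleton N0).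
by rewrite !(bil0l bil) mulr0 addr0.
Qed.

Let B_ge0 v : 0 <= B v.
Proof.
rewrite leNgt; apply/negP => Bv.
have H k := @om_le (k *: v) 0 (nbhs_singleton N0).
have {}H k : 0 <= M + C * (k ^+ 2 * B v).
  by have := H k; rewrite (bil0r bil) -/(B _) B_Z.
(* This scale makes the right-hand side equal to [M - (M + 1)], contradicting its non-negativity. *)
have := H (Num.sqrt ((M + 1) / (C * - B v))).
rewrite sqr_sqrtr; last first.
  by rewrite divr_ge0// ?addr_ge0// mulr_ge0 ?oppr_ge0// ltW.
have -> : C * ((M + 1) / (C * - B v) * B v) = - (M + 1).
  by field; rewrite lt_eqF// gt_eqF.
by lra.
Qed.

(** Apply the hypothesis to [(2 * r * C)^-1 *: v] and multiply by [4 * r ^+ 2 * C]: the coefficient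
    of [B v] becomes 1. *)
Let bound_scaled r h v : r != 0 -> N h ->
  2 * om v (r *: h) - B v <= r ^+ 2 * (4 * C * M).
Proof.
move=> r0 Nh; have := @om_le ((2 * r * C)^-1 *: v) h Nh.
rewrite -/(B _) B_Z (bilZl bil) (bilZr bil) => H.
have C0 : C != 0 by rewrite gt_eqF.
have r2 : 0 < r ^+ 2 by rewrite exprn_even_gt0.
have p : 0 < 4 * r ^+ 2 * C by rewrite mulr_gt0// mulr_gt0.
rewrite -(ler_pM2l p) in H.
have -> : 2 * (r * om v h) = 4 * r ^+ 2 * C * ((2 * r * C)^-1 * om v h).
  by field; rewrite C0 r0.
have E : 4 * r ^+ 2 * C * (M + C * ((2 * r * C)^-1 ^+ 2 * B v)) =
  r ^+ 2 * (4 * C * M) + B v by field; rewrite C0 r0.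
by rewrite E in H; rewrite lerBlDr.
Qed.

Let absorbing x : exists r h, [/\ r != 0, N h & x = r *: h].
Proof.
have H : (fun t : R => t *: x) @ 0^' --> (0 : V).
  rewrite -(scale0r x); apply: tvs_cvgZ; last exact: cvg_cst.
  by apply: cvg_within_filter; exact: cvg_id.
have nz : \forall t \near (0 : R)^', t != 0 by exact: nbhs_dnbhs_neq.
have [t [t0 Nt]] := filter_ex (filterI nz (H _ N0)).
exists t^-1, (t *: x); split => //.
  by rewrite invr_eq0.
by rewrite scalerA mulVf// scale1r.
Qed.

Let dual_has_sup x : has_sup [set 2 * om v x - om v (D v) | v in setT].
Proof.
split; first by exists (2 * om 0 x - om 0 (D 0)), 0.
have [r [h [r0 Nh ->]]] := absorbing x.
by exists (r ^+ 2 * (4 * C * M)) => _ [v _ <-]; exact: bound_scaled.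
Qed.

Lemma dual_form_ge v x : 2 * om v x - om v (D v) <= dual_form x.
Proof. by apply: ub_le_sup; [case: (dual_has_sup x) | exists v]. Qed.

Lemma dual_form_le x b :
  (forall v, 2 * om v x - om v (D v) <= b) -> dual_form x <= b.
Proof.
move=> H; apply: ge_sup; first by case: (dual_has_sup x).
by move=> _ [v _ <-].
Qed.

Lemma dual_form_ge0 x : 0 <= dual_form x.
Proof. by have := dual_form_ge 0 x; rewrite !(bil0l bil) mulr0 subr0. Qed.

Lemma dual_formZ r x : dual_form (r *: x) = r ^+ 2 * dual_form x.
Proof.
have [->|r0] := eqVneq r 0.
  rewrite scale0r expr0n mul0r; apply/eqP; rewrite eq_le dual_form_ge0 andbT.
  by apply: dual_form_le => v; rewrite (bil0r bil) mulr0 sub0r oppr_le0 B_ge0.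
(* Substituting [s *: v] in the supremum gives one inequality; the other is the same statement for
   [s^-1]. *)
have H s y : s != 0 -> dual_form (s *: y) <= s ^+ 2 * dual_form y.
  move=> s0; apply: dual_form_le => v.
  have p : 0 < s ^+ 2 by rewrite exprn_even_gt0.
  have := dual_form_ge (s^-1 *: v) y; rewrite -(ler_pM2l p); apply: le_trans.
  rewrite -/(B v) -/(B (_ *: _)) B_Z (bilZl bil) (bilZr bil) le_eqVlt.
  apply/orP; left.
  by apply/eqP; field.
apply/eqP; rewrite eq_le H//=.
have := @H r^-1 (r *: x); rewrite invr_eq0 scalerA mulVf// scale1r => /(_ r0).
by rewrite exprVn ler_pdivlMl// exprn_even_gt0.
Qed.

Lemma dual_form_parallelogram x y :
  dual_form (x + y) + dual_form (x - y) = 2 * (dual_form x + dual_form y).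
Proof.
(* The substitution (v, w) -> (v + w, v - w) gives one inequality for every
   pair; applied to (x + y, x - y) it gives the other. *)
have H a b : 2 * (dual_form a + dual_form b) <=
    dual_form (a + b) + dual_form (a - b).
  set S := _ + dual_form (a - b).
  have {}H v w : 2 * (2 * om v a - B v) + 2 * (2 * om w b - B w) <= S.
    have := dual_form_ge (v + w) (a + b).
    have := dual_form_ge (v - w) (a - b).
    have BN u : B (- u) = B u by rewrite -scaleN1r B_Z sqrrN expr1n mul1r.
    rewrite -!/(B _) !B_D BN (linmapN D_linear) !(bilNr bil) !(bilDl bil).
    rewrite !(bilDr bil) !(bilNl bil) !(bilNr bil) /S.
    by lra.
  have {}H w : dual_form a <= S / 2 - (2 * om w b - B w).
    by apply: dual_form_le => v; have := H v w; rewrite /B; lra.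
  have : dual_form b <= S / 2 - dual_form a.
    by apply: dual_form_le => w; have := H w; rewrite /B; lra.
  by lra.
apply/eqP; rewrite eq_le H andbT.
have := H (x + y) (x - y).
have -> : x + y + (x - y) = 2 *: x.
  by rewrite addrACA subrr addr0 scaler_nat mulr2n.
have -> : x + y - (x - y) = 2 *: y.
  by rewrite opprB (addrC y) addrACA subrr add0r scaler_nat mulr2n.
by rewrite !dual_formZ; lra.
Qed.

(** Completing the square: translating the supremum variable by [x] absorbs [D x]. *)
Lemma dual_form_shift x y :
  dual_form (D x + y) = dual_form y + om x (D x) + 2 * om x y.
Proof.
have E u : 2 * om (u + x) (D x + y) - B (u + x) =
    2 * om u y - B u + B x + 2 * om x y.
  by rewrite B_D (bilDl bil) !(bilDr bil) /B; ring.
apply/eqP; rewrite eq_le; apply/andP; split.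
  apply: dual_form_le => v; rewrite -(subrK x v) -/(B _) E.
  by have := dual_form_ge (v - x) y; rewrite /B; lra.
suff : dual_form y <= dual_form (D x + y) - B x - 2 * om x y by rewrite /B; lra.
apply: dual_form_le => u.
by have := dual_form_ge (u + x) (D x + y); rewrite -/(B _) E /B; lra.
Qed.

Definition dual_product : V -> V -> R := polar dual_form.

Lemma dual_product_D x y : dual_product (D x) y = om x y.
Proof.
have q0 : dual_form 0 = 0 by rewrite -(scale0r 0) dual_formZ expr0n mul0r.
have qD : dual_form (D x) = om x (D x).
  by have := dual_form_shift x 0; rewrite addr0 (bil0r bil) q0 mulr0 addr0 add0r.
by rewrite /dual_product /polar dual_form_shift qD; field.
Qed.

Let polD := @polarDl R V dual_form dual_form_parallelogram.

Let polZ := @polarZl R V dual_form dual_form_ge0 dual_formZ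
  dual_form_parallelogram.

Lemma dual_product_bilinear : is_bilinear dual_product.
Proof.
have H a x y z : dual_product (a *: x + y) z =
    a * dual_product x z + dual_product y z by rewrite /dual_product polD polZ.
move=> a x y z; split; first exact: H.
by rewrite /dual_product !(polarC dual_form z); exact: H.
Qed.

Lemma dual_product_gt0 x : x <> 0 -> 0 < dual_product x x.
Proof.
move=> x0; rewrite /dual_product (polarxx dual_formZ) lt_neqAle dual_form_ge0 andbT.
apply/negP => /eqP qx; apply: x0.
have [_ _ alt nd] := om_sympl; apply: nd => w.
rewrite (alternating_antisym bil alt); apply/eqP; rewrite oppr_eq0.
apply/negPn/negP => s0; have Bw := B_ge0 w.
(* With [s = om w x] nonzero and [k = s / (B w + 1)], the value [2 * k * s - k ^+ 2 * B w] is
   [k ^+ 2 * (B w + 2) > 0]. The added 1 covers the case [B w = 0]. *)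
have := dual_form_ge (om w x / (B w + 1) *: w) x.
have s2 : 0 < om w x ^+ 2 by rewrite exprn_even_gt0.
rewrite -/(B _) B_Z (bilZl bil) -qx.
have -> : 2 * (om w x / (B w + 1) * om w x) - (om w x / (B w + 1)) ^+ 2 * B w =
    (om w x / (B w + 1)) ^+ 2 * (B w + 2).
  by field; rewrite gt_eqF// ltr_wpDl.
apply/negP; rewrite -ltNge mulr_gt0//; last by rewrite ltr_wpDl.
by rewrite exprn_even_gt0//= mulf_neq0// invr_eq0 gt_eqF// ltr_wpDl.
Qed.

Let small_nbhs e : 0 < e -> nbhs 0 [set u | dual_form u <= e].
Proof.
move=> e0; pose K := 4 * C * M; have K0 : 0 <= K by rewrite !mulr_ge0// ltW.
(* Chosen so that [r <= 1] and [r * K <= e], whence [r ^+ 2 * K <= e]. *)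
pose r := e / (e + K); have r0 : 0 < r by rewrite divr_gt0// ltr_wpDr.
have rn0 : r != 0 by rewrite gt_eqF.
apply: filterS (nbhs0Z rn0 N0) => _ [h Nh <-] /=.
apply: dual_form_le => v; apply: le_trans (bound_scaled v rn0 Nh) _.
have r1 : r <= 1 by rewrite ler_pdivrMr ?ltr_wpDr// mul1r lerDl.
have rK : r * K <= e.
  rewrite /r mulrAC ler_pdivrMr ?ltr_wpDr// ler_pM2l//.
  by rewrite lerDr ltW.
by apply: le_trans rK; rewrite expr2 -mulrA ler_piMl// mulr_ge0// ltW.
Qed.

Lemma dual_form_continuous : continuous dual_form.
Proof.
move=> x0; apply/cvgrPdist_le => e e0.
(* The weight makes [k ^- 2 * dual_form x0 <= e / 2]; the remaining [e / 2] is left for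
   [(1 + k ^+ 2) * dual_form u]. *)
pose k := 1 + 2 * dual_form x0 / e.
have q0 := dual_form_ge0 x0.
have k1 : 1 <= k by rewrite lerDl divr_ge0// ?mulr_ge0// ltW.
have k0 : 0 < k by apply: lt_le_trans k1.
have d0 : 0 < e / (2 * (1 + k ^+ 2)).
  by rewrite divr_gt0// mulr_gt0// ltr_wpDr// sqr_ge0.
apply: filterS (nbhsT x0 (small_nbhs d0)) => _ [u /= qu <-].
have -> : dual_form (x0 + u) = dual_form x0 + dual_form u + 2 * polar dual_form u x0.
  by rewrite /polar (addrC u); field.
have kn0 : k != 0 by rewrite gt_eqF.
have := polar_weighted dual_form_ge0 dual_formZ dual_form_parallelogram u x0 kn0.
have E1 : k ^- 2 * dual_form x0 <= e / 2.
  rewrite ler_pdivrMl ?exprn_gt0//.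
  apply: le_trans (_ : k * (e / 2) <= _); last first.
    apply: ler_wpM2r; first by rewrite divr_ge0// ltW.
    by rewrite expr2 ler_peMl// ltW.
  have -> : k * (e / 2) = e / 2 + dual_form x0 by rewrite /k; field; rewrite gt_eqF.
  by rewrite lerDr divr_ge0// ltW.
have qu0 := dual_form_ge0 u.
have E2 : (1 + k ^+ 2) * dual_form u <= e / 2.
  rewrite -ler_pdivlMl; last by rewrite ltr_wpDr// sqr_ge0.
  apply: le_trans qu _; rewrite le_eqVlt; apply/orP; left; apply/eqP.
  by field; rewrite gt_eqF// ltr_wpDr// sqr_ge0.
move: E1 E2; set P := polar _ _ _; set Z := k ^- 2 * _; set Y := k ^+ 2.
rewrite !ler_norml; lra.
Qed.

Lemma dual_product_bicontinuous : bicontinuous dual_product.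
Proof.
move=> p; apply: cvgM; last exact: cvg_cst.
have c1 : (fun p : V * V => p.1) @ p --> p.1 by exact: continuous_fst.
have c2 : (fun p : V * V => p.2) @ p --> p.2 by exact: continuous_snd.
apply: cvgB; last by apply: continuous_cvg c2; exact: dual_form_continuous.
apply: cvgB; last by apply: continuous_cvg c1; exact: dual_form_continuous.
apply: continuous_cvg; first exact: dual_form_continuous.
exact: tvs_cvgD.
Qed.

Lemma dual_product_euclidean : euclidean_form dual_product.
Proof.
split; [exact: dual_product_bilinear | exact: dual_product_bicontinuous | |
  exact: dual_product_gt0].
by move=> x y; exact: polarC.
Qed.

(** Symplectic maps commuting with [D] only permute the family under the supremum; for [gam t] this
    yields orthogonality. *)
Lemma dual_product_invariant (g g' : V -> V) :
  is_linear_map g -> cancel g g' -> cancel g' g ->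
  (forall v w, om (g v) (g w) = om v w) -> (forall v, D (g v) = g (D v)) ->
  forall x y, dual_product (g x) (g y) = dual_product x y.
Proof.
move=> gl gK g'K gom Dg.
have q x : dual_form (g x) = dual_form x.
  apply/eqP; rewrite eq_le; apply/andP; split; apply: dual_form_le => v.
    rewrite -(g'K v) Dg !gom; exact: dual_form_ge.
  by have := dual_form_ge (g v) (g x); rewrite Dg !gom.
by move=> x y; rewrite /dual_product /polar -(linmapD gl) !q.
Qed.

End DualForm.

(** * From a semi-equicontinuous orbit to a double extension *)

Lemma linear_form_trip {R : realType} {V : tvsType R} (l : trip V -> R) :
  is_linear_form l -> forall x, l x =
    x.1.1 * l ((1, 0), 0) + l ((0, x.1.2), 0) + x.2 * l ((0, 0), 1).
Proof.
move=> ll [[z v] t] /=.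
have lD a x y : l (a *: x + y) = a * l x + l y by exact: ll.
have -> : ((z, v), t) =
    z *: ((1, 0), 0) + (t *: ((0, 0), 1) + ((0, v), 0)) :> trip V.
  congr (_, _, _) => /=; rewrite ?scaler0 ?add0r ?addr0//.
    by rewrite [z *: 1]mulr1.
  by rewrite [t *: 1]mulr1.
by rewrite !lD; ring.
Qed.

Lemma restrict_form_linear {R : realType} {V : tvsType R} (l : trip V -> R) :
  is_linear_form l -> is_linear_form (fun v => l ((0, v), 0)).
Proof.
move=> ll a x y; rewrite -ll.
by congr (l (_, _, _)); rewrite /= scaler0 addr0.
Qed.

Lemma restrict_form_continuous {R : realType} {V : tvsType R}
    (l : trip V -> R) : continuous l -> continuous (fun v => l ((0, v), 0)).
Proof.
move=> lc v; apply: (cvg_comp (fun v => ((0, v), 0) : trip V) l _ (lc ((0, v), 0))).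
apply: cvg_prod; last exact: cvg_cst.
by apply: cvg_prod; [exact: cvg_cst | exact: cvg_id].
Qed.

Lemma bounded_multiples_eq0 {R : realType} (a M : R) :
  (forall k, k * a <= M) -> a = 0.
Proof.
move=> H; apply/eqP/negPn/negP => a0.
by have := H ((M + 1) / a); rewrite mulfVK//; lra.
Qed.

Lemma semi_equicontinuous_bound {R : realType} {X : tvsType R}
    (E : set (X -> R)) : semi_equicontinuous E ->
  exists (x0 : X) (U : set X) M, nbhs x0 U /\ forall m y, E m -> U y -> m y <= M.
Proof.
move=> [x0 [U [nU [M HM]]]]; exists (- x0), (-%R @^-1` U), M; split.
  by apply: opp_continuous; rewrite opprK.
move=> m y Em /HM /(le_trans (lee_abs _)) supM; rewrite -lee_fin.
apply: le_trans supM; apply: ereal_sup_ubound.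
by exists m => //; rewrite opprK.
Qed.

Lemma nbhs_nonzero {R : realType} (t : R) (A : set R) :
  nbhs t A -> exists2 s, A s & s != 0.
Proof.
have [->|t0] := eqVneq t 0 => nA; last by exists t => //; exact: nbhs_singleton.
have nz : \forall s \near (0 : R)^', s != 0 by exact: nbhs_dnbhs_neq.
have nA' : \forall s \near (0 : R)^', A s by exact: nbhs_dnbhs.
by have [s [s0 As]] := filter_ex (filterI nz nA'); exists s.
Qed.

Section Forward.
Context {R : realType} {V : tvsType R} {om : V -> V -> R}.
Context {gam : R -> V -> V} {D : V -> V}.
Hypothesis om_sympl : symplectic_form om.
Hypothesis gam_act : smooth_symplectic_action om gam.
Hypothesis D_gen : is_generator gam D.

(** The curve [t |-> al (gam t v)] has derivative [al (D (gam t v)) = 0]. *)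
Lemma gam_invariant_form (al : V -> R) : is_linear_form al -> continuous al ->
  (forall v, al (D v) = 0) -> forall t v, al (gam t v) = al v.
Proof.
move=> all alc alD t v.
have alL : is_linear_map (al : V -> R^o) by exact: all.
have alB x y : al (x - y) = al x - al y by exact: (linmapB alL).
have alZ a x : al (a *: x) = a * al x by exact: (linmapZ alL).
pose f (s : R) : R := al (gam s v).
have -> : al v = f 0 by rewrite /f (gam0 gam_act).
apply: (@is_derive_0_is_cst R f t 0) => s.
have H : (fun h : R => h^-1 *: ((f \o shift s) (h *: 1) - f s)) @ 0^' --> (0 : R).
  rewrite -[X in _ --> X](alD (gam s v)).
  rewrite (_ : (fun h => _) =
      (fun h => al (h^-1 *: (gam h (gam s v) - gam s v)))).
    exact: (cvg_comp _ al (@D_gen (gam s v)) (@alc (D (gam s v)))).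
  apply/funext => h; rewrite alZ alB /f /= [h *: 1]mulr1.
  by rewrite (gamD gam_act).
apply: DeriveDef; first by apply/cvg_ex; exists 0.
by apply: cvg_lim => //; exact: Rhausdorff.
Qed.

Lemma coadj_orbit_trivial l : in_dual l -> l ((1, 0), 0) = 0 ->
  (forall v, l ((0, D v), 0) = 0) -> coadj_orbit om gam l = [set l].
Proof.
move=> [ll lc] l0 lD.
have lE := linear_form_trip ll.
pose al v := l ((0, v), 0).
have all : is_linear_form al by exact: restrict_form_linear.
have alL : is_linear_map (al : V -> R^o) by exact: all.
have alB x y : al (x - y) = al x - al y by exact: (linmapB alL).
have alZ a x : al (a *: x) = a * al x by exact: (linmapZ alL).
have alc : continuous al by exact: restrict_form_continuous.
have alg := gam_invariant_form all alc lD.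
have H g : l \o osc_Ad om gam D g = l.
  apply/funext => x; rewrite /= lE [RHS]lE /= l0 !mulr0 -!/(al _).
  by rewrite alB alZ alg [al (D _)]lD mulr0 subr0.
rewrite (coadj_orbitE om_sympl gam_act D_gen); apply/seteqP; split => m /=.
  by move=> [g ->].
by move=> ->; exists 0; rewrite H.
Qed.

Lemma semi_equicontinuous_orbit_bound l : in_dual l ->
  nontrivial_set (coadj_orbit om gam l) ->
  semi_equicontinuous (coadj_orbit om gam l) ->
  exists (N : set V) (M c : R), [/\ nbhs 0 N, c != 0 &
    forall v h, N h -> om v h <= M + c * om v (D v)].
Proof.
move=> ld nt /semi_equicontinuous_bound[[[z0 v0] t0] [U [M [nU HM]]]].
have [bil _ _ _] := om_sympl.
have [ll lc] := ld; have lE := linear_form_trip ll.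
have [[P T] /= [nP nT] PTU] := nU.
have [[A N] /= [nA nN] ANP] := nP.
have [t1 Tt1 t1n0] := nbhs_nonzero nT.
have Az := nbhs_singleton nA.
have Nv := nbhs_singleton nN.
have Dl := generator_linear om_sympl gam_act D_gen.
pose al v := l ((0, v), 0).
have alL : is_linear_map (al : V -> R^o) by exact: restrict_form_linear.
have alB x y : al (x - y) = al x - al y by exact: (linmapB alL).
have alD x y : al (x + y) = al x + al y by exact: (linmapD alL).
have alZ a x : al (a *: x) = a * al x by exact: (linmapZ alL).
set lam := l ((1, 0), 0) in lE *; set mu := l ((0, 0), 1) in lE *.
(* Group elements [((0, v), 0)] suffice; the last coordinate is frozen at a nonzero [t1], which
   keeps the quadratic term. *)
have {}HM v v' : N v' ->
    (z0 + om v v' - t1 / 2 * om v (D v)) * lam + (al v' - t1 * al (D v))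
      + t1 * mu <= M.
  move=> Nv'.
  have := HM (l \o osc_Ad om gam D ((0, v), 0)) ((z0, v'), t1) _ _.
  rewrite /= lE /= (gam0 gam_act) -/(al _) alB alZ; apply.
    by rewrite (coadj_orbitE om_sympl gam_act D_gen); exists ((0, v), 0).
  by apply: PTU; split => //=; exact: ANP.
have [lam0|lamn0] := eqVneq lam 0.
  exfalso; apply: nt; exists l; apply: coadj_orbit_trivial => // v.
  apply: (@bounded_multiples_eq0 _ _ ((M - al v0 - t1 * mu))) => k.
  have := HM (- (k / t1) *: v) v0 Nv.
  rewrite lam0 mulr0 (linmapZ Dl) alZ.
  have -> : t1 * (- (k / t1) * al (D v)) = - (k * al (D v)) by field.
  by rewrite /al; lra.
have alc : continuous al by exact: restrict_form_continuous.
have n1 : \forall h \near (0 : V), -1 < al h.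
  have al0 : al 0 = 0 by exact: (linmap0 alL).
  have := alc 0; rewrite /continuous_at al0 => /cvgr_gt; apply.
  by rewrite oppr_lt0.
have n2 : \forall h \near (0 : V), N (v0 + h).
  have : (fun h : V => v0 + h) @ (0 : V) --> v0.
    rewrite -[X in _ --> X](addr0 v0).
    by apply: tvs_cvgD; [exact: cvg_cst | exact: cvg_id].
  by move=> /(_ _ nN).
exists [set h | -1 < al h /\ N (v0 + h)],
  (2 * M + 1 - 2 * al v0 - 2 * z0 * lam - 2 * t1 * mu), (t1 / lam).
split; [exact: filterI | by rewrite mulf_neq0// invr_eq0 | move=> v h [h1 h2]].
(* Adding the bounds for [v] at [v0 + h] and for [- v] at [v0] cancels [om v v0] and [al (D v)];
   what remains is [om v h], the quadratic term, and [al h], which exceeds -1. *)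
have := HM (lam^-1 *: v) (v0 + h) h2; have := HM (- lam^-1 *: v) v0 Nv.
rewrite !(linmapZ Dl) !(bilZl bil) !(bilZr bil) (bilDr bil) alD !alZ.
move: (om v v0) (om v h) (om v (D v)) (al v0) (al h) (al (D v)) h1.
move=> a b B p r s h1.
have -> : (z0 + - lam^-1 * a - t1 / 2 * (- lam^-1 * (- lam^-1 * B))) * lam
  = z0 * lam - a - t1 / lam * B / 2 by field.
have -> : (z0 + lam^-1 * (a + b) - t1 / 2 * (lam^-1 * (lam^-1 * B))) * lam
  = z0 * lam + a + b - t1 / lam * B / 2 by field.
lra.
Qed.

Lemma symplectic_scale (s : R) : s != 0 ->
  symplectic_form (fun v w => s * om v w).
Proof.
move=> s0; have [bil bic alt nd] := om_sympl; split.
- move=> a x y z; rewrite (bilDl bil) (bilDr bil) (bilZl bil) (bilZr bil).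
  by split; ring.
- by move=> p; apply: cvgM; [exact: cvg_cst | exact: bic].
- by move=> v; rewrite alt mulr0.
- move=> v H; apply: nd => w; have /eqP := H w.
  by rewrite mulf_eq0 (negPf s0) => /eqP.
Qed.

Lemma osc_dext (N : set V) (M c : R) : nbhs 0 N -> c != 0 ->
  (forall v h, N h -> om v h <= M + c * om v (D v)) -> (exists v : V, v <> 0) ->
  exists (W : tvsType R) (ka : W -> W -> R) (E : W -> W) (del : R -> W -> W),
     [/\ euclidean_form ka, skew_operator ka E, E <> (fun _ => 0),
         smooth_orthogonal_action ka del /\ is_generator del E &
         lie_iso (osc_bracket om D) (dext_bracket ka E)].
Proof.
move=> nN c0 omN [v0 v0n0].
have [bil bic alt nd] := om_sympl.
have Dl := generator_linear om_sympl gam_act D_gen.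
pose s := Num.sg c.
have ss : s * s = 1 by rewrite -expr2 sqr_sg c0.
have s0 : s != 0 by rewrite sgr_eq0.
pose om' v w := s * om v w.
have om'_sympl : symplectic_form om' by exact: symplectic_scale.
have om'D v w : om' (D v) w = - om' v (D w).
  by rewrite /om' (generator_om om_sympl gam_act D_gen) mulrN.
have om'N v h : N h -> om' v h <= M + `|c| * om' v (D v).
  (* The sign [s] turns [om] into [om'] on the left, while the quadratic term is unchanged since
     [s * s = 1]. *)
  move=> Nh; have := omN (s *: v) h Nh.
  rewrite (linmapZ Dl) !(bilZl bil) (bilZr bil) -/(om' v h) => /le_trans; apply.
  rewrite /om' [`|c|]normrEsg -/s lerD2l le_eqVlt; apply/orP; left; apply/eqP.
  by ring.
have cp : 0 < `|c| by rewrite normr_gt0.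
have kaD := @dual_product_D _ _ _ _ om'_sympl Dl om'D _ _ _ nN cp om'N.
have kaE := @dual_product_euclidean _ _ _ _ om'_sympl Dl om'D _ _ _ nN cp om'N.
set ka := dual_product in kaD kaE.
exists V, ka, D, gam; split => //.
- have [_ _ kaC _] := kaE; have [_ _ alt' _] := om'_sympl.
  split => //; first exact: (generator_continuous om_sympl gam_act D_gen).
  move=> x y; rewrite (kaC x) !kaD.
  by apply: alternating_antisym; case: om'_sympl.
- move=> D0; apply: v0n0; apply: nd => w.
  have := kaD v0 w; rewrite D0 bil0l; last by case: kaE.
  by move/esym/eqP; rewrite mulf_eq0 (negPf s0) => /eqP.
- split => //; have [glin g0 gD gs] := gam_act; split => // t.
  have [gl [gc go]] := glin t; split => //; split => //.
  apply: (dual_product_invariant om'_sympl Dl nN cp om'N gl (g' := gam (- t))).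
  + exact: (gamNK gam_act).
  + exact: (gamKN gam_act).
  + by move=> v w; rewrite /om' go.
  + exact: (generator_gam om_sympl gam_act D_gen).
- pose f (x : trip V) : trip V := ((s * x.1.1, x.1.2), x.2).
  have fK : cancel f f.
    by move=> [[z v] t]; rewrite /f /= mulrA ss mul1r.
  have fc : continuous f.
    move=> x; apply: cvg_prod; last exact: continuous_snd.
    apply: cvg_prod; last first.
      exact: (cvg_comp _ _ (@continuous_fst _ _ x) (@continuous_snd _ _ x.1)).
    apply: (@tvs_cvgZl R R^o).
    exact: (cvg_comp _ _ (@continuous_fst _ _ x) (@continuous_fst _ _ x.1)).
  exists f, f; split => //.
    move=> a [[z v] t] [[z' v'] t']; congr (_, _, _) => /=.
    by rewrite mulrDr mulrCA.
  move=> [[z v] t] [[z' v'] t']; rewrite /f /osc_bracket /dext_bracket /=.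
  by rewrite kaD.
Qed.

End Forward.

(** * From an isomorphism with a double extension to a semi-equicontinuous orbit *)

Section Backward.
Context {R : realType} {V : tvsType R} {om : V -> V -> R}.
Context {gam : R -> V -> V} {D : V -> V}.
Hypothesis om_sympl : symplectic_form om.
Hypothesis gam_act : smooth_symplectic_action om gam.
Hypothesis D_gen : is_generator gam D.
Hypothesis V_neq0 : exists v : V, v <> 0.

Let bil : is_bilinear om. Proof. by case: om_sympl. Qed.

Lemma osc_bracket_nilpotent (x y : trip V) : x.2 = 0 ->
  let ad := osc_bracket om D x in ad (ad (ad y)) = 0.
Proof.
case: x y => [[z v] t] [[z' v'] t'] /= ->.
by rewrite /osc_bracket /= !scale0r !subr0 (bil0r bil).
Qed.

Lemma dual_z_coordinate : in_dual (fun x : trip V => x.1.1).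
Proof.
split; first by [].
move=> x; exact: (cvg_comp _ _ (@continuous_fst _ _ x) (@continuous_fst _ _ x.1)).
Qed.

(** Moving [gam g.2] to the other side of [om] leaves a single vector [u] describing each orbit
    element. *)
Lemma osc_Ad_z (g x : trip V) : exists u : V,
  (osc_Ad om gam D g x).1.1 = x.1.1 + om u x.1.2 - x.2 / 2 * om u (D u).
Proof.
exists (gam (- g.2) g.1.2); rewrite /osc_Ad /=.
rewrite (generator_gam om_sympl gam_act D_gen) (gam_om gam_act).
by rewrite -[in RHS](gamNK gam_act g.2 x.1.2) (gam_om gam_act).
Qed.

Lemma nonzero_pairing : exists v w, om v w != 0.
Proof.
have [_ _ _ nd] := om_sympl; have [v v0] := V_neq0.
apply: contrapT => H; apply: v0; apply: nd => w.
by apply/eqP/negPn/negP => vw; apply: H; exists v, w.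
Qed.

Lemma coadj_orbit_z_nontrivial :
  nontrivial_set (coadj_orbit om gam (fun x : trip V => x.1.1)).
Proof.
rewrite (coadj_orbitE om_sympl gam_act D_gen) => -[m mE].
have Hm g : (fun x : trip V => x.1.1) \o osc_Ad om gam D g = m.
  suff : [set m] ((fun x : trip V => x.1.1) \o osc_Ad om gam D g) by [].
  by rewrite -mE; exists g.
have [v [w /negP]] := nonzero_pairing; apply; apply/eqP.
(* At [((0, w), 0)] the orbit elements given by [((0, v), 0)] and by the identity differ by
   [om v w]. *)
have := congr1 (fun f => f ((0, w), 0)) (etrans (Hm ((0, v), 0)) (esym (Hm 0))).
by rewrite /osc_Ad /= !(gam0 gam_act) (bil0l bil) !mul0r !subr0 !add0r.
Qed.

Section Iso.
Context {W : tvsType R} {ka : W -> W -> R} {E : W -> W}.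
Hypothesis ka_eucl : euclidean_form ka.
Hypothesis E_skew : skew_operator ka E.
Hypothesis E_neq0 : E <> (fun _ => 0).
Context {phi : trip V -> trip W} {psi : trip W -> trip V}.
Hypothesis phi_lin : is_linear_map phi.
Hypothesis phi_cont : continuous phi.
Hypothesis phiK : cancel phi psi.
Hypothesis psiK : cancel psi phi.
Hypothesis phi_bracket : forall x y,
  phi (osc_bracket om D x y) = dext_bracket ka E (phi x) (phi y).

Let kbil : is_bilinear ka. Proof. by case: ka_eucl. Qed.

Let El : is_linear_map E. Proof. by case: E_skew. Qed.

Let ka_ge0 w : 0 <= ka w w.
Proof.
have [->|/eqP w0] := eqVneq w 0; first by rewrite (bil0l kbil).
by apply: ltW; case: ka_eucl => _ _ _; apply.
Qed.

(** Skewness gives [ka (E w) (E w) = - ka w (E (E w))]. Used twice, it keeps the third power of [E]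
    nonzero at [w]. *)
Let skew_sqr_neq0 w : E w <> 0 -> E (E w) <> 0.
Proof.
move=> Ew0 EEw0; have [_ _ _ /(_ _ Ew0)] := ka_eucl.
by case: E_skew => _ _ ->; rewrite EEw0 (bil0r kbil) oppr0 ltxx.
Qed.

(* [R x V x {0}] acts nilpotently, whereas [t != 0] acts through [t *: E]. *)
Let phi_t0 x : x.2 = 0 -> (phi x).2 = 0.
Proof.
move=> x0.
have [w Ew0] : exists w, E w <> 0.
  apply: contrapT => H; apply: E_neq0; apply/funext => w.
  by apply: contrapT => Ew; apply: H; exists w.
have := congr1 phi (@osc_bracket_nilpotent x (psi ((0, w), 0)) x0).
rewrite /= !phi_bracket psiK (linmap0 phi_lin) => /(congr1 (fun y => y.1.2)).
rewrite /dext_bracket /= !scale0r !subr0 !(linmapZ El) !scalerA => /eqP.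
rewrite scaler_eq0 => /orP[|/eqP /(skew_sqr_neq0 (skew_sqr_neq0 Ew0))//].
by rewrite !mulf_eq0 !orbb => /eqP.
Qed.

Let P v := (phi ((0, v), 0)).1.2.
Let c := (phi ((1, 0), 0)).1.1.
Let a := (phi ((0, 0), 1)).2.

Let phi_om v w : om v w *: phi ((1, 0), 0) = ((ka (E (P v)) (P w), 0), 0).
Proof.
rewrite -(linmapZ phi_lin).
have -> : om v w *: ((1, 0), 0) = osc_bracket om D ((0, v), 0) ((0, w), 0) :> trip V.
  rewrite /osc_bracket /= !scale0r subr0; congr (_, _, _) => /=.
  - by rewrite [_ *: 1]mulr1.
  - by rewrite scaler0.
  - by rewrite scaler0.
by rewrite phi_bracket /dext_bracket !phi_t0// !scale0r subr0.
Qed.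

Let ka_P v w : ka (E (P v)) (P w) = c * om v w.
Proof.
by have /(congr1 (fun y => y.1.1)) := phi_om v w; rewrite /= mulrC => <-.
Qed.

Let c_neq0 : c != 0.
Proof.
apply/eqP => c0; have [v [w vw]] := nonzero_pairing.
have := phi_om v w; rewrite ka_P c0 mul0r => /eqP.
rewrite scaler_eq0 (negPf vw) /= => /eqP pe.
have := phiK ((1, 0), 0); rewrite pe -(linmap0 phi_lin) phiK => -[/esym/eqP].
by rewrite oner_eq0.
Qed.

Let P_D v : P (D v) = a *: E (P v).
Proof.
have : phi ((0, D v), 0) = dext_bracket ka E (phi ((0, 0), 1)) (phi ((0, v), 0)).
  rewrite -phi_bracket; congr phi; rewrite /osc_bracket /=.
  by rewrite (bil0l bil) scale0r subr0 scale1r.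
move=> /(congr1 (fun y => y.1.2)).
rewrite /dext_bracket /= (phi_t0 (x := ((0, v), 0)))//.
by rewrite scale0r subr0.
Qed.

Let a_neq0 : a != 0.
Proof.
(* The last coordinate of [phi x] depends on [x.2] alone, so [a = 0] would contradict
   surjectivity. *)
have phi_t x : (phi x).2 = x.2 * a.
  case: x => [[z v] t].
  have -> : phi ((z, v), t) = t *: phi ((0, 0), 1) + phi ((z, v), 0).
    rewrite -phi_lin; congr (phi (_, _, _)); rewrite /= ?scaler0 ?add0r ?addr0//.
    by rewrite [_ *: 1]mulr1.
  by rewrite /= (phi_t0 (x := ((z, v), 0)))// addr0.
apply/eqP => a0; have := phi_t (psi ((0, 0), 1)).
by rewrite psiK a0 mulr0 /= => /eqP; rewrite oner_eq0.
Qed.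

Let om_D u : om u (D u) = a / c * ka (E (P u)) (E (P u)).
Proof.
have := ka_P u (D u); rewrite P_D (bilZr kbil) => H.
by apply: (mulfI c_neq0); rewrite -H; field.
Qed.

Let P_cont : continuous P.
Proof.
move=> v.
have H : (fun v => ((0, v), 0) : trip V) @ v --> (((0, v), 0) : trip V).
  apply: cvg_prod; last exact: cvg_cst.
  by apply: cvg_prod; [exact: cvg_cst | exact: cvg_id].
have H1 := cvg_comp _ phi H (phi_cont (x := ((0, v), 0))).
have H2 := cvg_comp _ _ H1 (@continuous_fst _ _ (phi ((0, v), 0))).
exact: (cvg_comp _ _ H2 (@continuous_snd _ _ (phi ((0, v), 0)).1)).
Qed.

Lemma coadj_orbit_z_semi_equicontinuous :
  semi_equicontinuous (coadj_orbit om gam (fun x : trip V => x.1.1)).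
Proof.
(* At this point [y.2 * (a / c)] equals -2, so it stays below -1 nearby and the quadratic term has a
   definite sign. *)
pose x0 : trip V := ((0, 0), - 2 * (c / a)).
have z1 : \forall y \near x0, `|y.1.1| < 1.
  have [_ zc] := dual_z_coordinate.
  have := zc x0; rewrite /continuous_at /= => /cvgr_norm_lt; apply.
  by rewrite normr0.
have k1 : \forall y \near x0, ka (P y.1.2) (P y.1.2) < 1.
  have yv : (fun y : trip V => y.1.2) @ x0 --> (0 : V).
    exact: (cvg_comp _ _ (@continuous_fst _ _ x0) (@continuous_snd _ _ x0.1)).
  have P0 : P 0 = 0 by rewrite /P (linmap0 phi_lin).
  have Py := cvg_comp _ P yv (P_cont (x := 0)).
  have [_ kbic _ _] := ka_eucl.
  have lt1 : ka (P 0) (P 0) < 1 by rewrite P0 (bil0l kbil).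
  exact: (@cvgr_lt R _ (nbhs x0) _ (fun y => ka (P y.1.2) (P y.1.2)) _
    (bilinear_cvg kbic Py Py) 1 lt1).
have t1 : \forall y \near x0, y.2 * (a / c) < - 1.
  have : (fun y : trip V => y.2 * (a / c)) @ x0 --> (- 2 * (c / a) * (a / c) : R).
    by apply: cvgM; [exact: (@continuous_snd _ _ x0) | exact: cvg_cst].
  rewrite [X in _ --> X](_ : _ = -2); last by field; rewrite a_neq0 c_neq0.
  by move=> /cvgr_lt; apply; lra.
exists x0, [set y : trip V | `|y.1.1| < 1 /\
  (ka (P y.1.2) (P y.1.2) < 1 /\ y.2 * (a / c) < - 1)].
split; first by apply: filterI => //; exact: filterI.
exists (1 + c ^- 2 / 2) => -[[z v] t] /= [z_lt [k_lt t_lt]].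
have upper m : coadj_orbit om gam (fun x : trip V => x.1.1) m ->
    m (- ((z, v), t)) <= 1 + c ^- 2 / 2.
  rewrite (coadj_orbitE om_sympl gam_act D_gen) => -[g ->].
  have [u uE] := osc_Ad_z g (- ((z, v), t)).
  rewrite [leLHS]uE /= (bilNr bil) om_D.
  (* This square bounds [- om u v] by half of [ka (E (P u)) (E (P u))] plus a constant; the
     quadratic term absorbs the former. *)
  have H := ka_ge0 (E (P u) + c^-1 *: P v).
  rewrite (bilDl kbil) !(bilDr kbil) !(bilZl kbil) !(bilZr kbil) in H.
  have [_ _ kaC _] := ka_eucl; rewrite (kaC (P v)) ka_P in H.
  have X0 := ka_ge0 (E (P u)).
  have c2 : 0 <= c ^- 2 by rewrite invr_ge0 sqr_ge0.
  rewrite mulrA -[c^-1 * c^-1]expr2 exprVn mulKf// in H.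
  have k2 : c ^- 2 * ka (P v) (P v) <= c ^- 2.
    by rewrite -[leRHS]mulr1 ler_wpM2l// ltW.
  have tX : t * (a / c) * ka (E (P u)) (E (P u)) <= - ka (E (P u)) (E (P u)).
    by rewrite -mulN1r ler_wpM2r// ltW.
  have -> : - t / 2 * (a / c * ka (E (P u)) (E (P u))) =
    - (t * (a / c) * ka (E (P u)) (E (P u)) / 2) by ring.
  by move: z_lt; rewrite ltr_norml => /andP[z_lt _]; lra.
(* The absolute value of the supremum also needs a lower bound; the base functional, a member of its
   own orbit, gives [- z]. *)
have lower : coadj_orbit om gam (fun x : trip V => x.1.1) (fun x => x.1.1).
  rewrite (coadj_orbitE om_sympl gam_act D_gen); exists 0; apply/funext => x /=.
  by rewrite !(bil0l bil) mulr0 subr0 addr0.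
set S := ereal_sup _.
have S1 : (S <= (1 + c ^- 2 / 2)%:E)%E.
  by apply: ge_ereal_sup => _ [m Om <-]; rewrite lee_fin; exact: upper.
have S2 : ((- (1 + c ^- 2 / 2))%:E <= S)%E.
  apply: le_trans (_ : (- z)%:E <= _)%E; last first.
    by apply: ereal_sup_ubound; exists (fun x => x.1.1).
  rewrite lee_fin lerN2; move: z_lt; rewrite ltr_norml => /andP[_ z_lt].
  have : 0 <= c ^- 2 by rewrite invr_ge0 sqr_ge0.
  by lra.
by case: S S1 S2 => [r| |]//=; rewrite !lee_fin ler_norml => -> ->.
Qed.

End Iso.
End Backward.

Theorem theorem3p2 (R : realType) (V : tvsType R) (om : V -> V -> R)
  (gam : R -> V -> V) (D : V -> V) :
  symplectic_form om ->
  smooth_symplectic_action om gam ->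
  is_generator gam D ->
  (exists v : V, v <> 0) ->
  (exists l : trip V -> R, in_dual l /\
     nontrivial_set (coadj_orbit om gam l) /\
     semi_equicontinuous (coadj_orbit om gam l))
  <->
  (exists (W : tvsType R) (ka : W -> W -> R) (E : W -> W) (del : R -> W -> W),
     [/\ euclidean_form ka, skew_operator ka E, E <> (fun _ => 0),
         smooth_orthogonal_action ka del /\ is_generator del E &
         lie_iso (osc_bracket om D) (dext_bracket ka E)]).
Proof.
move=> om_sympl gam_act D_gen Vn0; split.
  move=> [l [ld [nt se]]].
  have [N [M [c [nN c0 omN]]]] :=
    semi_equicontinuous_orbit_bound om_sympl gam_act D_gen ld nt se.
  exact: (osc_dext om_sympl gam_act D_gen nN c0 omN Vn0).
move=> [W [ka [E [del [kaE Esk En0 _ [phi [psi [pl pc _ [pK qK] pb]]]]]]]].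
exists (fun x : trip V => x.1.1); split; first exact: dual_z_coordinate.
split; first exact: (coadj_orbit_z_nontrivial om_sympl gam_act D_gen Vn0).
exact: (coadj_orbit_z_semi_equicontinuous om_sympl gam_act D_gen Vn0 kaE Esk En0
  pl pc pK qK pb).
Qed.
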